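(* Let $E_n = I\,[n,0]$ and $O_n = I\,[n,0]'$, $n\in\mathbb{Z}$, be the $I$-orbits in the affine flag variety $\mathrm{SL}_2((t))/I$ of $\mathrm{SL}_2$ over $\mathbb{C}$, and let $I_1\supset I_2\supset I_3$ be the subgroups of $I$ given in the context. Then: (1) For $n<0$, $E_n$ is an $I_1$-orbit. (2) For $n<0$, $O_n$ is an $I_1$-orbit. (3) For $n>0$, $E_n$ decomposes (as a disjoint union) into the $I_1$-orbits $$E_n^{\mathrm{o}} := [n, \mathbb{C}^{\times} t^{-n}+\mathbb{C} t^{-n+1}+\dots + \mathbb{C} t^{n-1}] \cong \mathbb{G}_m \times \mathbb{A}^{2n-1},$$ $$E_n^{\mathrm{h}} := [n, \mathbb{C} t^{-n+1}+\mathbb{C} t^{-n+2}+\dots + \mathbb{C} t^{n-1}] \cong \mathbb{A}^{2n-1}.$$ In fact, $I_3\,[n,t^{-n}] \supseteq E_n^{\mathrm{o}}$ and $I_2\,[n,0] \supseteq E_n^{\mathrm{h}}$. (4) For $n\ge 0$, $O_n$ decomposes (as a disjoint union) into the $I_1$-orbits $$O_n^{\mathrm{o}} := [n,\mathbb{C}^{\times} t^{-n}+\mathbb{C} t^{-n+1}+\dots + \mathbb{C} t^n]' \cong \mathbb{G}_m \times \mathbb{A}^{2n},$$ $$O_n^{\mathrm{h}} := [n, \mathbb{C} t^{-n+1}+ \mathbb{C} t^{-n+2}+\dots + \mathbb{C} t^n]' \cong \mathbb{A}^{2n}.$$ In fact, $I_3\,[n,t^{-n}]' \supseteq O_n^{\mathrm{o}}$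 and $I_2\,[n,0]' \supseteq O_n^{\mathrm{h}}$.
   Context: Everything is over $\mathbb{C}$, and only $\mathbb{C}$-points are considered. $\mathrm{SL}_2((t))$ is the group of $2\times 2$ matrices with entries in $\mathbb{C}((t))$ and determinant $1$. The standard Iwahori subgroup is $$I = \left\{\begin{pmatrix} a & b \\ tc & d\end{pmatrix} : a,b,c,d \in \mathbb{C}[[t]],\ ad-tbc = 1\right\}.$$ The quotient $\mathrm{SL}_2((t))/I$ is the affine flag variety (an ind-variety); $\mathrm{SL}_2((t))$ and its subgroups act on it by left multiplication. The following are subgroups of $I$: $$I_1 = \left\{\begin{pmatrix} a & tb \\ tc & d\end{pmatrix} : a,b,c,d \in \mathbb{C}[[t]],\ ad-t^2bc = 1\right\},$$ $$I_2 = \left\{\begin{pmatrix} a & tb \\ t^2c & d\end{pmatrix} : a,b,c,d \in \mathbb{C}[[t]],\ ad-t^3bc = 1\right\},$$ $$I_3 = \left\{\begin{pmatrix} a & t^2b \\ t^2c & d\end{pmatrix} : a,b,c,d \in \mathbb{C}[[t]],\ ad-t^4bc = 1\right\}.$$ For $n\in\mathbb{Z}$ and $p\in\mathbb{C}[t,t^{-1}]$ that is $0$ or of degree (largest exponent) $<n$, write $[n,p]$ for the coset $\begin{pmatrix} t^n & p \\ 0 & t^{-n}\end{pmatrix}I$. For $n\in\mathbb{Z}$ and $p\in\mathbb{C}[t,t^{-1}]$ that is $0$ or of degree $\le n$, write $[n,p]'$ for the coset $\begin{pmatrix} p & t^n \\ -t^{-n} & 0\end{pmatrix}I$. Every element of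 $\mathrm{SL}_2((t))/I$ is of exactly one of these two forms, for unique $n$ and $p$. For a set $S$ of Laurent polynomials, $[n,S]=\{[n,p]:p\in S\}$ and $[n,S]'=\{[n,p]':p\in S\}$. An expression $\mathbb{C} t^{i}+\dots+\mathbb{C} t^{j}$ denotes the span of $t^i,\dots,t^j$ (equal to $\{0\}$ if $j<i$), and $\mathbb{C}^\times t^i+\mathbb{C}t^{i+1}+\dots+\mathbb{C}t^j$ (with $j\ge i$) denotes the set of $\sum_{m=i}^j p_m t^m$ with $p_i\neq 0$. $\mathbb{A}^d$ is affine $d$-space and $\mathbb{G}_m=\mathbb{A}^1\setminus\{0\}$. *)

(* Defs.v *)
From HB Require Import structures.
From mathcomp Require Import all_boot all_order all_algebra.
From mathcomp Require Import zify ring.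
From mathcomp Require Import mathcomp_extra boolp classical_sets functions.
From mathcomp Require Import cardinality fsbigop reals.
From mathcomp Require Import complex.

Set Implicit Arguments.
Unset Strict Implicit.
Unset Printing Implicit Defensive.
Import Order.TTheory GRing.Theory Num.Theory.
Local Open Scope classical_set_scope.
Local Open Scope ring_scope.

(** * The ring K((t)) of formal Laurent series *)

Section Laurent.
Variable K : fieldType.
Implicit Types f g h : int -> K.

Definition bounded_below : {pred int -> K} :=
  fun f => `[< exists N : int, forall m, m < N -> f m = 0 >].

Lemma bounded_belowP f :
  reflect (exists N : int, forall m, m < N -> f m = 0) (f \in bounded_below).
Proof. exact: asboolP. Qed.

Lemma bounded_below_zmod_closed : zmod_closed bounded_below.
Proof.
split; first by apply/bounded_belowP; exists 0.
move=> f g /bounded_belowP[N Nf] /bounded_belowP[M Mg].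
apply/bounded_belowP; exists (Num.min N M) => m; rewrite lt_min => /andP[mN mM].
by rewrite -[(f - g) m]/(f m - g m) Nf// Mg// subrr.
Qed.
HB.instance Definition _ :=
  GRing.isZmodClosed.Build (int -> K) bounded_below bounded_below_zmod_closed.

(* [coef f m] is the coefficient of t^m in [f]. *)
Record laurent := Laurent { coef :> int -> K; _ : coef \in bounded_below }.

HB.instance Definition _ := [isSub for coef].
HB.instance Definition _ := [Choice of laurent by <:].
HB.instance Definition _ := [SubChoice_isSubZmodule of laurent by <:].

Lemma laurentP (f g : laurent) : (forall m, coef f m = coef g m) -> f = g.
Proof. by move=> fg; apply/val_inj/funext. Qed.

Lemma coef_bound (f : laurent) : exists N : int, forall m, m < N -> coef f m = 0.
Proof. by apply/bounded_belowP; case: f. Qed.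

Lemma coefD (f g : laurent) m : coef (f + g) m = coef f m + coef g m.
Proof. by []. Qed.

(* The sum has finite support when [f] and [g] are bounded below. *)
Definition conv f g : int -> K :=
  fun m => \sum_(i \in [set: int]) f i * g (m - i).

Lemma conv_lt f g (a b : int) :
  (forall m, m < a -> f m = 0) -> (forall m, m < b -> g m = 0) ->
  forall m, m < a + b -> conv f g m = 0.
Proof.
move=> fa gb m mab; rewrite /conv fsbig1// => i _.
have [ia|ai] := ltP i a; first by rewrite fa// mul0r.
by rewrite gb ?mulr0//; lia.
Qed.

Lemma convE f g (a b : int) :
  (forall m, m < a -> f m = 0) -> (forall m, m < b -> g m = 0) ->
  forall k : nat, conv f g (a + b + k%:Z) =
    \sum_(j < k.+1) f (a + j%:Z) * g (b + (k - j)%N%:Z).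
Proof.
move=> fa gb k; rewrite /conv.
pose r : seq int := [seq a + j%:Z | j <- iota 0 k.+1].
have r_uniq : uniq r by rewrite map_inj_uniq ?iota_uniq// => x y; lia.
have fg0 i : [set: int] i -> i \notin r -> f i * g (a + b + k%:Z - i) = 0.
  move=> _ ni; have [ia|ai] := ltP i a; first by rewrite fa// mul0r.
  rewrite gb ?mulr0// ltNge; apply: contra ni => ge; apply/mapP.
  by exists (absz (i - a)%R); [rewrite mem_iota; lia|lia].
rewrite (fsbigE r _ r_uniq _ fg0)//.
under eq_bigl do rewrite in_setT.
rewrite big_map -[iota 0 k.+1]/(index_iota 0 k.+1) big_mkord.
by apply: eq_bigr => j _; congr (_ * g _); have := ltn_ord j; lia.
Qed.

Lemma conv_bounded (f g : laurent) : conv f g \in bounded_below.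
Proof.
have [a fa] := coef_bound f; have [b gb] := coef_bound g.
by apply/bounded_belowP; exists (a + b); exact: conv_lt.
Qed.

Definition lmul (f g : laurent) : laurent := Laurent (conv_bounded f g).

Lemma tpow_bounded (n : int) : (fun m : int => (m == n)%:R : K) \in bounded_below.
Proof. by apply/bounded_belowP; exists n => m mn; rewrite lt_eqF. Qed.

(* The monomial t^n. *)
Definition tpow (n : int) : laurent := Laurent (tpow_bounded n).

Lemma lmulC : commutative lmul.
Proof.
move=> f g; apply: laurentP => m /=.
have [a fa] := coef_bound f; have [b gb] := coef_bound g.
have [mab|abm] := ltP m (a + b).
  by rewrite (conv_lt fa gb)// (conv_lt gb fa)// addrC.
have -> : m = a + b + (absz (m - (a + b))%R)%:Z by lia.
set k := absz _; rewrite (convE fa gb) (addrC a) (convE gb fa).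
rewrite (reindex_inj rev_ord_inj) /=; apply: eq_bigr => j _.
rewrite mulrC subSS; congr (coef g _ * _).
by have := ltn_ord j; lia.
Qed.

Lemma lmulDl : left_distributive lmul +%R.
Proof.
move=> f g h; apply: laurentP => m; rewrite coefD /=.
have [a fa] := coef_bound f; have [b gb] := coef_bound g.
have [c hc] := coef_bound h.
pose d := Num.min a b.
have fd i : i < d -> coef f i = 0 by move=> id; apply: fa; lia.
have gd i : i < d -> coef g i = 0 by move=> id; apply: gb; lia.
have fgd i : i < d -> coef (f + g) i = 0.
  by move=> id; rewrite coefD fd// gd// addr0.
have [mab|abm] := ltP m (d + c).
  by rewrite (conv_lt fgd hc)// (conv_lt fd hc)// (conv_lt gd hc)// addr0.
have -> : m = d + c + (absz (m - (d + c))%R)%:Z by lia.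
rewrite (convE fgd hc) (convE fd hc) (convE gd hc) -big_split /=.
by apply: eq_bigr => j _; rewrite -mulrDl.
Qed.

Lemma lmulA : associative lmul.
Proof.
move=> f g h; apply: laurentP => m /=.
have [a fa] := coef_bound f; have [b gb] := coef_bound g.
have [c hc] := coef_bound h.
have fgab := conv_lt fa gb; have ghbc := conv_lt gb hc.
have [mab|abm] := ltP m (a + b + c).
  by rewrite (conv_lt fgab hc)// (conv_lt fa ghbc)// addrA.
have -> : m = a + b + c + (absz (m - (a + b + c))%R)%:Z by lia.
set k := absz _; rewrite (convE fgab hc) -(addrA a b c) (convE fa ghbc).
pose P (u : int -> K) (e : int) := \poly_(i < k.+1) u (e + i%:Z).
have P2 u v d e : (forall i, i < d -> u i = 0) -> (forall i, i < e -> v i = 0) ->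
    forall i, (i < k.+1)%N -> (P u d * P v e)`_i = conv u v (d + e + i%:Z).
  move=> ud ve i ik; rewrite (convE ud ve) coefM; apply: eq_bigr => j _.
  by rewrite !coef_poly !ifT//; have := ltn_ord j; lia.
transitivity ((P f a * (P g b * P h c))`_k).
  rewrite coefM; apply: eq_bigr => j _; rewrite P2//; last by lia.
  by rewrite coef_poly ltn_ord.
rewrite mulrA coefM; apply: eq_bigr => j _; rewrite P2//.
by rewrite coef_poly ifT//; lia.
Qed.

Lemma lmul1 : left_id (tpow 0) lmul.
Proof.
move=> f; apply: laurentP => m /=; rewrite /conv.
rewrite (fsbigE [:: 0])//=.
  by rewrite big_cons big_nil ?in_setT eqxx mul1r subr0 addr0.
by move=> i _; rewrite inE => /negPf ->; rewrite mul0r.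
Qed.

Lemma lone_neq0 : tpow 0 != 0.
Proof.
by apply/eqP => /(congr1 (coef^~ 0)) /eqP; rewrite (oner_eq0 K).
Qed.

HB.instance Definition _ :=
  GRing.Zmodule_isComNzRing.Build laurent lmulA lmulC lmul1 lmulDl lone_neq0.

Definition power_series : set laurent := [set f | forall m, m < 0 -> coef f m = 0].

(* K t^i + ... + K t^j, and its subset K^* t^i + K t^(i+1) + ... + K t^j;
   the former is {0} when j < i. *)
Definition lspan (i j : int) : set laurent :=
  [set p | forall m, coef p m != 0 -> i <= m <= j].
Definition lspan_unit (i j : int) : set laurent :=
  [set p | lspan i j p /\ coef p i != 0].

End Laurent.

(** * SL_2(K((t))), the affine flag variety and orbits *)

Section AffineFlag.
Variable K : fieldType.
Let L := laurent K.
Let t : int -> L := @tpow K.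

Definition mx2 (a b c d : L) : 'M[L]_2 :=
  \matrix_(i, j) if i == 0 then (if j == 0 then a else b)
                 else (if j == 0 then c else d).

Definition SL2 : set 'M[L]_2 := [set g | \det g = 1].

(* Matrices (a, t^k b; t^l c, d) with a, b, c, d in K[[t]] and determinant 1. *)
Definition congruence_subgroup (k l : nat) : set 'M[L]_2 :=
  [set g | exists a b c d : L,
    [/\ power_series a, power_series b, power_series c & power_series d] /\
    g = mx2 a (t k * b) (t l * c) d /\ a * d - t (k + l)%N * b * c = 1].

Definition Iwahori := congruence_subgroup 0 1.
Definition I1 := congruence_subgroup 1 1.
Definition I2 := congruence_subgroup 1 2.
Definition I3 := congruence_subgroup 2 2.

(* Points of SL_2((t))/I are left cosets, as sets of matrices. *)
Definition translate (g : 'M[L]_2) (X : set 'M[L]_2) : set 'M[L]_2 :=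
  [set g *m x | x in X].
Definition iw_coset (g : 'M[L]_2) := translate g Iwahori.
Definition affine_flag : set (set 'M[L]_2) := [set iw_coset g | g in SL2].

Definition flag_orbit (H : set 'M[L]_2) (X : set 'M[L]_2) : set (set 'M[L]_2) :=
  [set translate h X | h in H].
Definition is_orbit (H : set 'M[L]_2) (S : set (set 'M[L]_2)) :=
  exists2 X, affine_flag X & S = flag_orbit H X.

(* [n, p] and [n, p]' *)
Definition brk (n : int) (p : L) := iw_coset (mx2 (t n) p 0 (t (- n))).
Definition brk' (n : int) (p : L) := iw_coset (mx2 p (t n) (- t (- n)) 0).

Definition orbE (n : int) := flag_orbit Iwahori (brk n 0).
Definition orbO (n : int) := flag_orbit Iwahori (brk' n 0).

Definition orbE_o (n : int) := [set brk n p | p in lspan_unit (- n) (n - 1)].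
Definition orbE_h (n : int) := [set brk n p | p in lspan (1 - n) (n - 1)].
Definition orbO_o (n : int) := [set brk' n p | p in lspan_unit (- n) n].
Definition orbO_h (n : int) := [set brk' n p | p in lspan (1 - n) n].

End AffineFlag.
Arguments SL2 : clear implicits.
Arguments congruence_subgroup : clear implicits.
Arguments Iwahori : clear implicits.
Arguments I1 : clear implicits.
Arguments I2 : clear implicits.
Arguments I3 : clear implicits.
Arguments affine_flag : clear implicits.
Arguments orbE : clear implicits.
Arguments orbO : clear implicits.
Arguments orbE_o : clear implicits.
Arguments orbE_h : clear implicits.
Arguments orbO_o : clear implicits.
Arguments orbO_h : clear implicits.

(** * Varieties as spaces with functions *)

Section Spaces.
Variable K : fieldType.

(* Everything is described through K-points, which is faithful (also for the
   countably many coordinates of SL_2((t))) for K = C, or more generally for K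
   algebraically closed and uncountable.

   A space is a set of points (inside an ambient type) with a topology and, for each open
   [V], the K-valued functions that are regular on [V]; a function is given on
   the whole ambient type, but only its values on [V] matter. *)
Record fun_space := FunSpace {
  fs_point : Type;
  carrier : set fs_point;
  is_open : set fs_point -> Prop;
  is_regular : set fs_point -> (fs_point -> K) -> Prop }.
Arguments carrier : clear implicits.
Arguments is_open : clear implicits.
Arguments is_regular : clear implicits.

Definition isomorphic (X Y : fun_space) :=
  exists phi : fs_point X -> fs_point Y,
    let pre V := carrier X `&` phi @^-1` V in
    [/\ set_bij (carrier X) (carrier Y) phi,
        forall V, V `<=` carrier Y -> (is_open Y V <-> is_open X (pre V)) &
        forall V (h : fs_point Y -> K), is_open Y V ->
          (is_regular Y V h <-> is_regular X (pre V) (h \o phi))].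

(* Polynomials in finitely many members of a family of coordinate functions. *)
Inductive polyfun (T J : Type) (x : J -> T -> K) : (T -> K) -> Prop :=
| polyfun_const c : polyfun x (fun=> c)
| polyfun_coord j : polyfun x (x j)
| polyfun_add P Q : polyfun x P -> polyfun x Q -> polyfun x (fun y => P y + Q y)
| polyfun_mul P Q : polyfun x P -> polyfun x Q -> polyfun x (fun y => P y * Q y).

(* Zariski-open subsets of S: locally, they contain a principal open subset. *)
Definition zariski_open T J (x : J -> T -> K) (S V : set T) :=
  V `<=` S /\ forall y, V y -> exists P, [/\ polyfun x P, P y != 0 &
    forall z, S z -> P z != 0 -> V z].

(* Regular functions: locally quotients of polynomials. *)
Definition zariski_regular T J (x : J -> T -> K) (V : set T) (f : T -> K) :=
  forall y, V y -> exists P Q, [/\ polyfun x P, polyfun x Q, Q y != 0 &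
    forall z, V z -> Q z != 0 -> f z = P z / Q z].

Definition affine_coord d (j : 'I_d) (v : 'rV[K]_d) : K := v 0 j.

Definition affine_subspace d (S : set 'rV[K]_d) : fun_space :=
  @FunSpace 'rV[K]_d S (zariski_open (@affine_coord d) S)
    (zariski_regular (@affine_coord d)).

Definition affine_space d : fun_space := @affine_subspace d setT.

(* G_m x A^d as the principal open subset x_0 <> 0 of A^1 x A^d = A^(d+1). *)
Definition Gm_affine_space d : fun_space :=
  @affine_subspace d.+1 [set v | v 0 0 != 0].

(* SL_2((t)) is the increasing union, over N, of the matrices whose entries have
   poles of order at most N, each a closed subset of an infinite-dimensional
   affine space whose coordinates are the coefficients of the entries. *)
Let G := 'M[laurent K]_2.

Definition loop_coord (j : 'I_2 * 'I_2 * int) (g : G) : K :=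
  coef (g j.1.1 j.1.2) j.2.

Definition pole_le (N : nat) : set G :=
  [set g | forall i j m, m < - N%:Z -> coef (g i j) m = 0].

Definition loop_open (S V : set G) :=
  V `<=` S /\
  forall N, zariski_open loop_coord (S `&` pole_le N) (V `&` pole_le N).

Definition loop_regular (V : set G) (f : G -> K) :=
  forall N, zariski_regular loop_coord (V `&` pole_le N) f.

(* The structure on a subset S of SL_2((t))/I is the quotient structure: open
   sets and regular functions are those that become so after pulling back along
   the projection SL_2((t)) -> SL_2((t))/I.  As this projection has local
   sections in the Zariski topology, for locally closed S this is the structure
   of (reduced) subvariety of the ind-variety SL_2((t))/I. *)
Definition flag_preimage (S : set (set G)) : set G :=
  [set g | SL2 K g /\ S (iw_coset g)].

Definition flag_subspace (S : set (set G)) : fun_space :=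
  @FunSpace (set G) S
    (fun V => V `<=` S /\ loop_open (flag_preimage S) (flag_preimage V))
    (fun V f => loop_regular (flag_preimage V) (f \o @iw_coset K)).

End Spaces.
Arguments affine_space : clear implicits.
Arguments Gm_affine_space : clear implicits.

(* Main.v *)
Require Import Defs.
From HB Require Import structures.
From mathcomp Require Import all_boot all_order all_algebra.
From mathcomp Require Import zify ring.
From mathcomp Require Import boolp classical_sets functions fsbigop reals complex.

(** Write [t^n p = P] and [shear P = (1, P; 0, 1)].  Then [[n, p]] is the coset
    of [shear P * D], with [D = diag(t^n, t^-n)], and [[n, p]'] is the coset of
    [shear (- P) * D * w], with [w = (0, 1; -1, 0)].  Up to this sign both families
    are therefore orbits of shears through a base point; they are treated together
    as [flag_point b n P], where [b] tells them apart.  Moving a matrix of the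
    Iwahori subgroup [I] across the base point shows that only [P] modulo [t^N]
    matters, where [N = 2n + b] ([iw_coset_base_point]).  When [N > 0] an element
    [h = (a, b; c, d)] of [I] sends the point [P] to the point [Q] as soon as
    [Q = (aP + b) / (cP + d)] modulo [t^N] ([translate_flag_point]): the group
    acts by Moebius transformations of C[[t]]/(t^N).

    - For [N <= 0] the constant shears fix the base point.  Multiplying [h] on the
      right by one of them clears the constant term of its upper right entry, so
      [I] and [I_1] have the same orbit ([Iwahori_orbit_I1]).
    - For [N > 0] the shears in [I] already reach every [P], so the [I]-orbit of the
      base point is the set of all [P] of degree [< N].  In [I_1] the constant
      terms of [b] and [c] vanish, so [Q(0) = P(0) a(0) / d(0)], and whether
      [P(0) = 0] is an invariant ([I1_stable]).  The points with [P(0) = 0] are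
      reached from [0] by shears lying in [I_2] ([I2_transitive_h]).  Any two points
      with [P(0), Q(0) <> 0] are related by an upper triangular matrix of [I_3], whose
      diagonal is chosen so that its upper right entry vanishes modulo [t^2]; this
      takes a square root and a division by 2 ([I3_transitive_o]).
    - For the geometry, the coefficients of [P] are coordinates on a cell.  The
      representatives [shear P * base_point] form a polynomial section of
      SL_2((t)) -> SL_2((t))/I over it.  Conversely, if [g] represents the point
      [P], then one column [(x, y)] of [t^n g] has [y] a unit and [x = P y] modulo
      [t^N], which can be solved for the coefficients of [P] by rational functions
      of [g] whose only denominators are powers of [y(0)] ([flag_point_coef_rational]).
      A polynomial section and rational coordinates together give an isomorphism for
      the quotient structure ([flag_isomorphic]), and also the injectivity that makes
      the two pieces disjoint. *)

Set Implicit Arguments.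
Unset Strict Implicit.
Unset Printing Implicit Defensive.
Import Order.TTheory GRing.Theory Num.Theory.
Local Open Scope classical_set_scope.
Local Open Scope ring_scope.

(** * Laurent series: order and division *)

Section LaurentSeries.
Variable K : fieldType.
Implicit Types (f g p u : laurent K) (m n i j : int).

Definition ord_ge m f : Prop := forall i, i < m -> coef f i = 0.

Lemma ord_ge_le m n f : n <= m -> ord_ge m f -> ord_ge n f.
Proof. by move=> nm fm i ni; apply: fm; lia. Qed.

Lemma ord_ge0 m : ord_ge m 0. Proof. by []. Qed.

Lemma lcoefD f g m : coef (f + g) m = coef f m + coef g m. Proof. by []. Qed.

Lemma lcoefN f m : coef (- f) m = - coef f m. Proof. by []. Qed.

Lemma lcoef1 m : coef (1 : laurent K) m = (m == 0)%:R. Proof. by []. Qed.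

Lemma ord_geD m f g : ord_ge m f -> ord_ge m g -> ord_ge m (f + g).
Proof. by move=> fm gm i im; rewrite lcoefD fm// gm// addr0. Qed.

Lemma ord_geN m f : ord_ge m f -> ord_ge m (- f).
Proof. by move=> fm i im; rewrite lcoefN fm// oppr0. Qed.

Lemma ord_geM m n f g : ord_ge m f -> ord_ge n g -> ord_ge (m + n) (f * g).
Proof. by move=> fm gn; exact: conv_lt. Qed.

Lemma ord_geMw m n k f g :
  ord_ge m f -> ord_ge n g -> k <= m + n -> ord_ge k (f * g).
Proof. by move=> fm gn kmn; apply: ord_ge_le kmn _; exact: ord_geM. Qed.

Lemma ord_ge_tpow n : ord_ge n (tpow K n).
Proof. by move=> i ni /=; rewrite lt_eqF. Qed.

Lemma ord_ge1 : ord_ge 0 (1 : laurent K).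
Proof. exact: ord_ge_tpow. Qed.

Lemma lcoefM f g : ord_ge 0 f -> ord_ge 0 g -> forall k : nat,
  coef (f * g) k = \sum_(j < k.+1) coef f j%:Z * coef g (k - j)%N.
Proof.
move=> f0 g0 k; rewrite -[LHS]/(conv f g k) -[k%:Z]add0r -[X in X + _]addr0.
by rewrite (convE f0 g0); apply: eq_bigr => j _; rewrite !add0r.
Qed.

Lemma lcoefM_last f g : ord_ge 0 f -> ord_ge 0 g -> forall k : nat,
  coef (f * g) k =
  \sum_(j < k) coef f j%:Z * coef g (k - j)%N + coef f k * coef g 0.
Proof. by move=> f0 g0 k; rewrite (lcoefM f0 g0) big_ord_recr /= subnn. Qed.

Lemma lcoefM_lead m n f g : ord_ge m f -> ord_ge n g ->
  coef (f * g) (m + n) = coef f m * coef g n.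
Proof.
move=> fm gn; rewrite -[LHS]/(conv f g (m + n)) -[m + n]addr0 (convE fm gn 0).
by rewrite big_ord1 !addr0.
Qed.

Lemma coef_tpowM n f m : coef (tpow K n * f) m = coef f (m - n).
Proof.
rewrite -[LHS]/(conv (tpow K n) f m) /conv (fsbigE [:: n])//=.
  by rewrite big_cons big_nil in_setT eqxx mul1r addr0.
by move=> i _; rewrite inE => /negPf ->; rewrite mul0r.
Qed.

Lemma tpowD m n : tpow K (m + n) = tpow K m * tpow K n.
Proof.
by apply: laurentP => i; rewrite coef_tpowM /=; congr (_%:R); lia.
Qed.

Lemma tpowK n : tpow K n * tpow K (- n) = 1.
Proof. by rewrite -tpowD subrr. Qed.

Lemma tpowVK n f : tpow K n * (tpow K (- n) * f) = f.
Proof. by rewrite mulrA tpowK mul1r. Qed.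

Lemma series_bounded m (a : int -> K) :
  (fun i : int => if m <= i then a i else 0) \in @bounded_below K.
Proof. by apply/bounded_belowP; exists m => i im; rewrite leNgt im. Qed.

Definition series m a : laurent K := Laurent (series_bounded m a).

Lemma coef_series m a i : coef (series m a) i = if m <= i then a i else 0.
Proof. by []. Qed.

Lemma ord_ge_series m n a : n <= m -> ord_ge n (series m a).
Proof. by move=> nm i im; rewrite coef_series ifF//; lia. Qed.

Lemma lspan_ord m n p : lspan m n p -> ord_ge m p.
Proof. by move=> pmn i im; apply: contraTeq im => /pmn; lia. Qed.

Lemma lspan_split (r : nat) :
  @lspan K 0 r = @lspan_unit K 0 r `|` @lspan K 1 r.
Proof.
apply/seteqP; split=> [p pr|p [[]//|pr m /pr]]; last by lia.
have [p0|p0] := eqVneq (coef p 0) 0; [right|by left] => m pm.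
have := pr m pm; have [m0|] := eqVneq m 0; last by lia.
by rewrite m0 p0 eqxx in pm.
Qed.

(** Power series are divided by a unit one coefficient at a time.  A quotient to
    finite precision is all that the action on the cells requires, and it comes
    out as the polynomial that labels a point. *)
Lemma unit_division f u (N : nat) : ord_ge 0 f -> ord_ge 0 u -> coef u 0 != 0 ->
  exists2 p, lspan 0 (N%:Z - 1) p & ord_ge N (f - p * u).
Proof.
move=> f0 u0 uN0; elim: N => [|N [p pN fpN]].
  by exists 0 => [m|]; rewrite ?eqxx// mul0r subr0.
pose c := coef (f - p * u) N / coef u 0.
pose q := series N (fun i => if i == N then c else 0).
have qN : ord_ge N q by exact: ord_ge_series.
exists (p + q) => [m|m mN].
  rewrite lcoefD coef_series; have [->|mN] := eqVneq m N; first by lia.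
  by rewrite if_same addr0 => /pN; lia.
rewrite mulrDl opprD addrA lcoefD lcoefN.
have [->|mN'] := eqVneq m N; last first.
  by rewrite fpN ?(ord_geMw qN u0 (lexx _))//; [rewrite subr0|lia|lia].
have := lcoefM_lead qN u0; rewrite addr0 => ->.
by rewrite coef_series lexx eqxx divfK// subrr.
Qed.

End LaurentSeries.

Section LinearUnit.
Variable K : fieldType.

(** Geometric series: [u = s0 + s1 t] and [v = 1 / u].  An exact inverse is needed
    because [u] and [v] become the diagonal of a matrix of determinant 1. *)
Lemma linear_unit (s0 s1 : K) : s0 != 0 -> exists u v : laurent K,
  [/\ ord_ge 0 u, ord_ge 0 v, u * v = 1, coef u 0 = s0 /\ coef u 1 = s1 &
      coef v 0 = s0^-1 /\ coef v 1 = - s1 / s0 ^+ 2].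
Proof.
move=> s00; pose c := - (s1 / s0).
pose u := series 0 (fun i => if i == 0 then s0 else if i == 1 then s1 else 0).
pose v := series 0 (fun i => s0^-1 * c ^+ absz i).
have u0 : ord_ge 0 u by exact: ord_ge_series.
have v0 : ord_ge 0 v by exact: ord_ge_series.
exists u, v; split=> //.
- apply: laurentP => m; have [m0|] := ltP m 0.
    by rewrite lcoef1 (lt_eqF m0) (ord_geM u0 v0)//; lia.
  case: m => // k _; rewrite (lcoefM u0 v0) lcoef1; case: k => [|k].
    by rewrite big_ord1 /= expr0 mulr1 divff.
  rewrite !big_ord_recl big1 ?addr0 => [|j _]; last by rewrite /= mul0r.
  rewrite !coef_series /= /bump /= !subSS !subn0 exprS /c; field.
  exact: s00.
- by rewrite !coef_series /= expr0 mulr1 expr1 /c; split=> //; field.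
Qed.

End LinearUnit.

(** * Cosets of the Iwahori subgroup *)

Lemma det2 (R : comNzRingType) (g : 'M[R]_2) :
  \det g = g 0 0 * g 1 1 - g 0 1 * g 1 0.
Proof.
rewrite (expand_det_row _ 0) !big_ord_recl big_ord0 addr0 /cofactor !det_mx11.
rewrite !mxE /= expr0 mul1r expr1 mulN1r mulrN.
by congr (g _ _ * g _ _ - g _ _ * g _ _); apply: val_inj.
Qed.

Section Flag.
Variable K : fieldType.
Local Notation L := (laurent K).
Local Notation t := (@tpow K).
Local Notation G := 'M[L]_2.
Implicit Types (g h k m : G) (P Q : L) (n : int) (b : bool).

Lemma mx2_eta g : g = mx2 (g 0 0) (g 0 1) (g 1 0) (g 1 1).
Proof.
by apply/matrixP => i j; rewrite mxE; case: i j => [[|[|]]//= ?] [[|[|]]//= ?];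
  congr (g _ _); apply: val_inj.
Qed.

Lemma mx2E (a b c d : L) :
  (mx2 a b c d 0 0 = a) * (mx2 a b c d 0 1 = b) *
  (mx2 a b c d 1 0 = c) * (mx2 a b c d 1 1 = d).
Proof. by rewrite /mx2 !mxE. Qed.

Lemma mx2M (a b c d a' b' c' d' : L) :
  mx2 a b c d *m mx2 a' b' c' d' =
  mx2 (a * a' + b * c') (a * b' + b * d') (c * a' + d * c') (c * b' + d * d').
Proof.
apply/matrixP => i j; rewrite !mxE !big_ord_recl big_ord0 !mxE /= addr0.
by case: (i == 0); case: (j == 0).
Qed.

Lemma mx2_1 : 1%:M = mx2 1 0 0 1 :> G.
Proof.
by apply/matrixP => i j; rewrite !mxE; case: i j => [[|[|]]//= ?] [[|[|]]//= ?].
Qed.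

Lemma det_mx2E g : \det g = g 0 0 * g 1 1 - g 0 1 * g 1 0.
Proof. exact: det2. Qed.

Lemma det_mx2 (a b c d : L) : \det (mx2 a b c d) = a * d - b * c.
Proof. by rewrite det_mx2E !mx2E. Qed.

Lemma congruenceP (i j : nat) g : congruence_subgroup K i j g <->
  \det g = 1 /\ [/\ ord_ge 0 (g 0 0), ord_ge i (g 0 1), ord_ge j (g 1 0)
                  & ord_ge 0 (g 1 1)].
Proof.
split=> [[a [b [c [d [[a0 b0 c0 d0] [-> dt]]]]]]|[dt [g00 g01 g10 g11]]].
  rewrite det_mx2 !mx2E; split.
    by rewrite -dt PoszD tpowD; ring.
  by split=> //; rewrite -[X in ord_ge X]addr0; apply: ord_geM => //;
    exact: ord_ge_tpow.
exists (g 0 0), (t (- i%:Z) * g 0 1), (t (- j%:Z) * g 1 0), (g 1 1); split.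
  by split=> // m m0; rewrite coef_tpowM; [apply: g01|apply: g10]; lia.
rewrite !mulrA !tpowK !mul1r -mx2_eta; split=> //.
rewrite -dt det_mx2E PoszD tpowD; have ti := tpowK K i; have tj := tpowK K j.
transitivity (g 0 0 * g 1 1 -
    (t i * t (- i%:Z)) * (t j * t (- j%:Z)) * (g 0 1 * g 1 0)); first ring.
by rewrite ti tj !mul1r.
Qed.

Lemma mx2_congruence (i j : nat) (a b c d : L) :
  ord_ge 0 a -> ord_ge i b -> ord_ge j c -> ord_ge 0 d -> a * d - b * c = 1 ->
  congruence_subgroup K i j (mx2 a b c d).
Proof.
by move=> *; apply/congruenceP; rewrite det_mx2 !mx2E.
Qed.

Lemma congruence_sub (i j i' j' : nat) : (i' <= i)%N -> (j' <= j)%N ->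
  congruence_subgroup K i j `<=` congruence_subgroup K i' j'.
Proof.
move=> ii jj g /congruenceP[dt [g00 g01 g10 g11]]; apply/congruenceP.
by split=> //; split=> //; [apply: ord_ge_le g01|apply: ord_ge_le g10].
Qed.

Lemma congruence1 (i j : nat) : congruence_subgroup K i j 1%:M.
Proof.
rewrite mx2_1; apply: mx2_congruence => //; try exact: ord_ge1.
by rewrite mulr1 mulr0 subr0.
Qed.

Lemma congruenceM (i j : nat) g h : congruence_subgroup K i j g ->
  congruence_subgroup K i j h -> congruence_subgroup K i j (g *m h).
Proof.
move=> /congruenceP[dg [g00 g01 g10 g11]] /congruenceP[dh [h00 h01 h10 h11]].
apply/congruenceP; rewrite det_mulmx dg dh mulr1; split=> //.
rewrite [g]mx2_eta [h]mx2_eta mx2M !mx2E.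
split; apply: ord_geD.
- by apply: ord_geMw g00 h00 _.
- by apply: ord_geMw g01 h10 _; lia.
- by apply: ord_geMw g00 h01 _; lia.
- by apply: ord_geMw g01 h11 _; lia.
- by apply: ord_geMw g10 h00 _; lia.
- by apply: ord_geMw g11 h10 _; lia.
- by apply: ord_geMw g10 h01 _; lia.
- by apply: ord_geMw g11 h11 _.
Qed.

Lemma congruenceV (i j : nat) g : congruence_subgroup K i j g ->
  exists2 g', congruence_subgroup K i j g' & g *m g' = 1%:M.
Proof.
move=> /congruenceP[dg [g00 g01 g10 g11]].
exists (mx2 (g 1 1) (- g 0 1) (- g 1 0) (g 0 0)).
  apply: mx2_congruence; rewrite ?mulrNN// -?dg ?det_mx2E; try exact: ord_geN.
  ring.
rewrite [X in X *m _]mx2_eta mx2M mx2_1 -dg det_mx2E; congr mx2; ring.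
Qed.

(** Since [g 0 1 * g 1 0] has positive order, the determinant condition at [t = 0]
    involves the diagonal only. *)
Lemma congruence_unit (i j : nat) g : (0 < i + j)%N ->
  congruence_subgroup K i j g -> coef (g 0 0) 0 * coef (g 1 1) 0 = 1.
Proof.
move=> ij /congruenceP[dg [g00 g01 g10 g11]].
have := congr1 (fun f : L => coef f 0) dg.
have := lcoefM_lead g00 g11; rewrite addr0 det_mx2E lcoefD lcoefN => ->.
by rewrite (ord_geM g01 g10) ?subr0//; lia.
Qed.

Lemma translate_iw_coset h g : translate h (iw_coset g) = iw_coset (h *m g).
Proof.
rewrite /iw_coset /translate image_comp.
by apply: eq_imagel => x _; rewrite /= mulmxA.
Qed.

Lemma iw_coset_mulr g k : Iwahori K k -> iw_coset (g *m k) = iw_coset g.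
Proof.
move=> Ik; apply/seteqP; split=> _ [x Ix <-].
  by exists (k *m x); [exact: congruenceM|rewrite mulmxA].
have [k' Ik' kk'] := congruenceV Ik.
exists (k' *m x); first exact: congruenceM.
by rewrite -mulmxA [k *m _]mulmxA kk' mul1mx.
Qed.

Lemma iw_coset_eq g h : iw_coset g = iw_coset h ->
  exists2 k, Iwahori K k & g = h *m k.
Proof.
move=> gh; have : iw_coset g g by exists 1%:M; [exact: congruence1|rewrite mulmx1].
by rewrite gh => -[k Ik <-]; exists k.
Qed.

(** The two series of points are [D I] and [D w I] with [D = diag(t^n, t^-n)] and
    [w = (0, 1; -1, 0)]: [b] is the exponent of [w]. *)
Definition base_point b n : G :=
  if b then mx2 0 (t n) (- t (- n)) 0 else mx2 (t n) 0 0 (t (- n)).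
Definition shear P : G := mx2 1 P 0 1.
Definition flag_point b n P := iw_coset (shear P *m base_point b n).

Lemma shear_mulmx P (a b c d : L) :
  shear P *m mx2 a b c d = mx2 (a + P * c) (b + P * d) c d.
Proof. by rewrite mx2M; congr mx2; ring. Qed.

Lemma shear_mulmxE P g i j :
  (shear P *m g) i j = if i == 0 then g 0 j + P * g 1 j else g 1 j.
Proof.
have l1 : lift ord0 ord0 = 1 :> 'I_2 by exact: val_inj.
rewrite mxE !big_ord_recl big_ord0 addr0 l1 /shear !mxE.
by case: (i == 0) => /=; rewrite ?mul0r !mul1r ?add0r.
Qed.

(** The argument of [flag_point] is [t^n p], a power series for the points of
    interest, so that elements of [I] act on it without shifts. *)
Lemma brkE n P : brk n P = flag_point false n (t n * P).
Proof.
by rewrite /brk /flag_point shear_mulmx mulr0 addr0 add0r mulrAC tpowK mul1r.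
Qed.

(** The sign comes from moving [w] past the shear; it disappears from the sets of
    points considered, which are symmetric. *)
Lemma brk'E n P : brk' n P = flag_point true n (- (t n * P)).
Proof.
by rewrite /brk' /flag_point shear_mulmx mulr0 addr0 add0r mulrNN mulrAC tpowK mul1r.
Qed.

Lemma det_shear P : \det (shear P) = 1.
Proof. by rewrite det_mx2 mulr1 mulr0 subr0. Qed.

Lemma det_base_point b n : \det (base_point b n) = 1.
Proof.
case: b; rewrite det_mx2; first by rewrite mul0r sub0r mulrN opprK tpowK.
by rewrite mul0r subr0 tpowK.
Qed.

Lemma flag_point_affine_flag b n P : affine_flag K (flag_point b n P).
Proof.
exists (shear P *m base_point b n) => //.
by rewrite /SL2/= det_mulmx det_shear det_base_point mulr1.
Qed.

(** The conditions on [k] say that it lies in the stabiliser [B I B^-1] of the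
    coset of [B = base_point b n]: conjugation by [diag(t^n, t^-n)] shifts the
    off-diagonal orders by [2n] in opposite directions, and conjugation by [w]
    exchanges their roles, which moves one unit of order from one to the other. *)
Lemma iw_coset_base_point b n k : \det k = 1 ->
  ord_ge 0 (k 0 0) -> ord_ge (n + n + b) (k 0 1) ->
  ord_ge (1 - b%:Z - n - n) (k 1 0) -> ord_ge 0 (k 1 1) ->
  forall g, iw_coset (g *m k *m base_point b n) = iw_coset (g *m base_point b n).
Proof.
move=> dk k00 k01 k10 k11 g; have tt := tpowK K n.
pose up := t (- n) * (t (- n) * k 0 1); pose lo := t n * (t n * k 1 0).
(* [k'] is the conjugate [B^-1 k B]. *)
pose k' : G := if b then mx2 (k 1 1) (- lo) (- up) (k 0 0)
  else mx2 (k 0 0) up lo (k 1 1).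
have sq a c : t n * (t n * a) * (t (- n) * (t (- n) * c)) = a * c.
  transitivity ((t n * t (- n)) * (t n * t (- n)) * (a * c)); first ring.
  by rewrite tt; ring.
have tpowKV c : t (- n) * (t n * c) = c by rewrite mulrCA tpowVK.
have Ik' : Iwahori K k'.
  rewrite /k' /up /lo; case: b k01 k10 {k'} => k01 k10; apply: mx2_congruence => //.
  - apply: ord_geN; rewrite mulrA -tpowD.
    by apply: (ord_geMw (@ord_ge_tpow K _) k10); lia.
  - apply: ord_geN; rewrite mulrA -tpowD.
    by apply: (ord_geMw (@ord_ge_tpow K _) k01); lia.
  - by rewrite -dk det_mx2E mulrNN sq; ring.
  - rewrite mulrA -tpowD.
    by apply: (ord_geMw (@ord_ge_tpow K _) k01); lia.
  - rewrite mulrA -tpowD.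
    by apply: (ord_geMw (@ord_ge_tpow K _) k10); lia.
  - by rewrite -dk det_mx2E [X in _ - X = _]mulrC sq; ring.
rewrite -[RHS](iw_coset_mulr _ Ik') -!mulmxA; congr (iw_coset (_ *m _)).
rewrite [in LHS](mx2_eta k) /base_point /k' /up /lo.
by case: b {k' k01 k10 Ik'}; rewrite !mx2M; congr mx2;
  rewrite ?mul0r ?mulr0 ?add0r ?addr0 ?mulrN ?mulNr ?opprK ?tpowVK ?tpowKV// mulrC.
Qed.

End Flag.

(** * Orbits through Moebius transformations *)

Section Orbits.
Variable K : fieldType.
Local Notation L := (laurent K).
Local Notation t := (@tpow K).
Local Notation G := 'M[L]_2.
Variables (b : bool) (n : int) (r : nat).
Hypothesis nbr : n + n + b%:Z = r.+1%:Z.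
Implicit Types (h : G) (P Q : L).

(** The last hypothesis reads [Q = (aP + b) / (cP + d)] modulo [t^(r+1)], cleared of
    its denominator.  It makes the upper right entry of
    [m = shear (- Q) * h * shear P] small enough for [m] to fix the base point. *)
Lemma translate_flag_point h P Q : Iwahori K h -> ord_ge 0 P -> ord_ge 0 Q ->
  ord_ge r.+1 (h 0 0 * P + h 0 1 - Q * (h 1 0 * P + h 1 1)) ->
  translate h (flag_point b n P) = flag_point b n Q.
Proof.
move=> /congruenceP[dh [h00 h01 h10 h11]] P0 Q0 hPQ.
rewrite translate_iw_coset mulmxA.
pose m := mx2 (h 0 0 - Q * h 1 0) (h 0 0 * P + h 0 1 - Q * (h 1 0 * P + h 1 1))
              (h 1 0) (h 1 0 * P + h 1 1).
have -> : h *m shear P = shear Q *m m.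
  by rewrite [X in X *m _]mx2_eta /m /shear !mx2M; congr mx2; ring.
have h10' : ord_ge 0 (h 1 0) by exact: ord_ge_le h10.
apply: iw_coset_base_point; rewrite /m ?mx2E.
- by rewrite det_mx2 -dh det_mx2E; ring.
- by apply: ord_geD => //; apply: ord_geN; apply: ord_geMw Q0 h10' _.
- by apply: ord_ge_le hPQ; lia.
- by apply: ord_ge_le h10; lia.
- by apply: ord_geD => //; apply: ord_geMw h10' P0 _.
Qed.

(** The quotient [(aP + b) / (cP + d)] exists because [d] is a unit and [c] is divisible
    by [t].  The relation between constant terms is what separates the orbits of
    [I_1]. *)
Lemma Iwahori_stable h P : Iwahori K h -> ord_ge 0 P ->
  exists2 Q, lspan 0 r Q & translate h (flag_point b n P) = flag_point b n Q /\
    coef Q 0 * coef (h 1 1) 0 = coef (h 0 0) 0 * coef P 0 + coef (h 0 1) 0.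
Proof.
move=> Ih P0; have [dh [h00 h01 h10 h11]] := (congruenceP 0 1 h).1 Ih.
pose u := h 1 0 * P + h 1 1; pose f := h 0 0 * P + h 0 1.
have f0 : ord_ge 0 f by apply: ord_geD => //; apply: ord_geMw h00 P0 _.
have u0 : ord_ge 0 u by apply: ord_geD => //; apply: ord_geMw h10 P0 _.
have u00 : coef u 0 = coef (h 1 1) 0.
  by rewrite lcoefD (ord_geM h10 P0) ?add0r.
have f00 : coef f 0 = coef (h 0 0) 0 * coef P 0 + coef (h 0 1) 0.
  by rewrite lcoefD -(lcoefM_lead h00 P0).
have uN0 : coef u 0 != 0.
  have /eqP := congruence_unit (isT : (0 < 0 + 1)%N) Ih.
  by apply: contraTneq; rewrite u00 => ->; rewrite mulr0 eq_sym oner_eq0.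
have [Q Qr fQu] := unit_division r.+1 f0 u0 uN0.
have Q0 := lspan_ord Qr.
exists Q; first by move=> m /Qr; lia.
split; first exact: translate_flag_point.
have := fQu 0 isT; rewrite lcoefD lcoefN => /eqP; rewrite subr_eq0 => /eqP.
by rewrite f00 => ->; rewrite -u00 -(lcoefM_lead Q0 u0).
Qed.

Lemma translate_shear P : translate (shear P) (flag_point b n 0) = flag_point b n P.
Proof.
by rewrite /flag_point translate_iw_coset mulmxA [shear 0]/shear -mx2_1 mulmx1.
Qed.

Lemma shear_congruence (i j : nat) P : ord_ge i P ->
  congruence_subgroup K i j (shear P).
Proof.
move=> Pi; apply: mx2_congruence; rewrite ?mulr0 ?mulr1 ?subr0//; exact: ord_ge1.
Qed.

Lemma Iwahori_orbit :
  flag_orbit (Iwahori K) (flag_point b n 0) = flag_point b n @` lspan 0 r.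
Proof.
apply/seteqP; split=> [_ [h Ih <-]|_ [P Pr <-]].
  by have [Q Qr [-> _]] := Iwahori_stable Ih (@ord_ge0 K 0); exists Q.
by exists (shear P); [exact: shear_congruence (lspan_ord Pr)|exact: translate_shear].
Qed.

(** A shear lies in [I_2] when its parameter is divisible by [t], its lower left entry
    being zero. *)
Lemma I2_transitive_h :
  flag_point b n @` lspan 1 r `<=` flag_orbit (I2 K) (flag_point b n 0).
Proof.
move=> _ [P Pr <-]; exists (shear P); last exact: translate_shear.
exact: shear_congruence (lspan_ord Pr).
Qed.

(** For [h] in [I_1] the constant term of [b] is zero, so [Q(0) d(0) = a(0) P(0)] with
    [a(0)] and [d(0)] nonzero. *)
Lemma I1_stable h P : I1 K h -> ord_ge 0 P ->
  exists2 Q, lspan 0 r Q &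
    translate h (flag_point b n P) = flag_point b n Q /\
    (coef Q 0 == 0) = (coef P 0 == 0).
Proof.
move=> I1h P0; have Ih : Iwahori K h by apply: congruence_sub I1h.
have [Q Qr [hPQ Q0]] := Iwahori_stable Ih P0; exists Q => //; split=> //.
have [_ [_ h01 _ _]] := (congruenceP 1 1 h).1 I1h.
move: Q0; rewrite (h01 0 isT) addr0 => Q0.
have /eqP := congruence_unit (isT : (0 < 1 + 1)%N) I1h.
have [a0|a0] := eqVneq (coef (h 0 0) 0) 0.
  by rewrite a0 mul0r eq_sym oner_eq0.
have [d0|d0 _] := eqVneq (coef (h 1 1) 0) 0.
  by rewrite d0 mulr0 eq_sym oner_eq0.
by have := congr1 (eq_op^~ 0) Q0; rewrite /= !mulf_eq0 (negPf a0) (negPf d0) orbF.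
Qed.

Lemma I1_orbit_h :
  flag_orbit (I1 K) (flag_point b n 0) = flag_point b n @` lspan 1 r.
Proof.
apply/seteqP; split=> [_ [h Ih <-]|X /I2_transitive_h[h hI <-]]; last first.
  by exists h => //; apply: congruence_sub hI.
have [Q Qr [-> Q0]] := I1_stable Ih (@ord_ge0 K 0); exists Q => // m Qm.
have := Qr m Qm; have [m0|] := eqVneq m 0; last lia.
by move: Qm Q0; rewrite m0 => /negPf ->; rewrite eqxx.
Qed.

Section UnitOrbit.
Hypothesis K_sqrt : forall x : K, exists y, y ^+ 2 = x.
Hypothesis K_2 : 2%:R != 0 :> K.

(** The matrix [h = (1/s, Q s - P/s; 0, s)] sends [P] to [Q] for every unit [s], since
    [P/s + (Q s - P/s) = Q s].  It lies in [I_3] when [Q s^2 = P] modulo [t^2], which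
    prescribes the first two coefficients of [s] and leaves the others free. *)
Lemma I3_transitive_o P Q : ord_ge 0 P -> coef P 0 != 0 ->
  ord_ge 0 Q -> coef Q 0 != 0 ->
  exists2 h, I3 K h & translate h (flag_point b n P) = flag_point b n Q.
Proof.
move=> P0 PN0 Q0 QN0; have [s0 s0E] := K_sqrt (coef P 0 / coef Q 0).
have s00 : s0 != 0.
  by rewrite -sqrf_eq0 s0E mulf_eq0 negb_or PN0 invr_eq0.
have P0E : coef P 0 = s0 ^+ 2 * coef Q 0 by rewrite s0E divfK.
(* [s0] and [s1] solve [Q (s0 + s1 t)^2 = P] modulo [t^2]. *)
pose s1 := (coef P 1 / s0 - coef Q 1 * s0) / (2%:R * coef Q 0).
have [s [s' [so s'o ss' [sc0 sc1] [s'c0 s'c1]]]] := linear_unit s1 s00.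
pose h := mx2 s' (Q * s - P * s') 0 s.
have I3h : I3 K h.
  apply: mx2_congruence => //; last by rewrite mulr0 subr0 mulrC.
  have c1 f g : ord_ge 0 f -> ord_ge 0 g ->
      coef (f * g : L) 1 = coef f 0 * coef g 1 + coef f 1 * coef g 0.
    move=> fo go; rewrite (lcoefM fo go 1) !big_ord_recl big_ord0 addr0.
    by rewrite /bump /= subn0 subnn.
  move=> m m2; have [m0|] := ltP m 0.
    by rewrite lcoefD lcoefN (ord_geM Q0 so) ?(ord_geM P0 s'o)// subr0.
  case: m m2 => // -[|[|//]] _ _.
  - rewrite lcoefD lcoefN (lcoefM_lead Q0 so) (lcoefM_lead P0 s'o) sc0 s'c0 P0E.
    by field.
  - rewrite lcoefD lcoefN !c1// sc0 sc1 s'c0 s'c1 P0E /s1.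
    by field; rewrite QN0 s00.
exists h => //; apply: translate_flag_point => //.
  by apply: congruence_sub I3h.
rewrite !mx2E.
suff -> : s' * P + (Q * s - P * s') - Q * (0 * P + s) = 0 by exact: ord_ge0.
ring.
Qed.

Lemma I1_orbit_o P : lspan_unit 0 r P ->
  flag_orbit (I1 K) (flag_point b n P) = flag_point b n @` lspan_unit 0 r.
Proof.
move=> [Pr PN0]; have P0 := lspan_ord Pr.
apply/seteqP; split=> [_ [h Ih <-]|_ [Q [Qr QN0] <-]].
  have [Q Qr [-> Q0]] := I1_stable Ih P0; exists Q => //.
  by split=> //; rewrite Q0.
have [h I3h <-] := I3_transitive_o P0 PN0 (lspan_ord Qr) QN0.
by exists h => //; apply: congruence_sub I3h.
Qed.

End UnitOrbit.
End Orbits.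

(** * Rational functions *)

Section RationalFunctions.
Variables (K : fieldType) (T J : Type) (x : J -> T -> K).

Lemma polyfun_comp (T' J' : Type) (y : J' -> T' -> K) (s : T -> T') P :
  (forall j, polyfun x (y j \o s)) -> polyfun y P -> polyfun x (P \o s).
Proof.
move=> xs; elim=> [c|j|P1 P2 _ IH1 _ IH2|P1 P2 _ IH1 _ IH2].
- exact: polyfun_const.
- exact: xs.
- exact: polyfun_add IH1 IH2.
- exact: polyfun_mul IH1 IH2.
Qed.

Lemma polyfun_sum n (F : 'I_n -> T -> K) :
  (forall i, polyfun x (F i)) -> polyfun x (fun z => \sum_i F i z).
Proof.
move=> xF; elim: n F xF => [|n IH] F xF.
  rewrite (_ : (fun _ => _) = fun=> 0); first exact: polyfun_const.
  by apply: funext => z; rewrite big_ord0.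
rewrite (_ : (fun _ => _) = fun z => F ord0 z + \sum_i F (lift ord0 i) z).
  by apply: polyfun_add => //; exact: IH.
by apply: funext => z; rewrite big_ord_recl.
Qed.

(** A single global fraction suffices for the coordinates met below; this is stronger
    than being regular on [A], and easier to compute with. *)
Definition rational_on (A : set T) (f : T -> K) := exists P Q,
  [/\ polyfun x P, polyfun x Q & forall z, A z -> Q z != 0 /\ f z = P z / Q z].

Variable A : set T.

Lemma rational_eq f g : rational_on A f -> (forall z, A z -> f z = g z) ->
  rational_on A g.
Proof.
move=> [P [Q [xP xQ PQ]]] fg; exists P, Q; split=> // z Az.
by rewrite -fg//; exact: PQ.
Qed.

Lemma rational_poly P : polyfun x P -> rational_on A P.
Proof.
move=> xP; exists P, (fun=> 1); split=> // [|z _]; first exact: polyfun_const.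
by rewrite oner_neq0 divr1.
Qed.

Lemma rationalD f g : rational_on A f -> rational_on A g ->
  rational_on A (fun z => f z + g z).
Proof.
move=> [P [Q [xP xQ fE]]] [P' [Q' [xP' xQ' gE]]].
exists (fun z => P z * Q' z + P' z * Q z), (fun z => Q z * Q' z); split.
- by apply: polyfun_add; exact: polyfun_mul.
- exact: polyfun_mul.
- move=> z Az; have [Qz ->] := fE z Az; have [Q'z ->] := gE z Az.
  by split; [rewrite mulf_neq0|rewrite addf_div].
Qed.

Lemma rationalM f g : rational_on A f -> rational_on A g ->
  rational_on A (fun z => f z * g z).
Proof.
move=> [P [Q [xP xQ fE]]] [P' [Q' [xP' xQ' gE]]].
exists (fun z => P z * P' z), (fun z => Q z * Q' z); split.
- exact: polyfun_mul.
- exact: polyfun_mul.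
- move=> z Az; have [Qz ->] := fE z Az; have [Q'z ->] := gE z Az.
  by split; [rewrite mulf_neq0|rewrite mulf_div].
Qed.

Lemma rationalV P : polyfun x P -> (forall z, A z -> P z != 0) ->
  rational_on A (fun z => (P z)^-1).
Proof.
move=> xP P0; exists (fun=> 1), P; split=> // [|z Az]; first exact: polyfun_const.
by rewrite P0// div1r.
Qed.

Lemma rational_sum n (F : 'I_n -> T -> K) :
  (forall i, rational_on A (F i)) -> rational_on A (fun z => \sum_i F i z).
Proof.
move=> xF; elim: n F xF => [|n IH] F xF.
  apply: (@rational_eq (fun=> 0)); first exact/rational_poly/polyfun_const.
  by move=> z _; rewrite big_ord0.
apply: (@rational_eq (fun z => F ord0 z + \sum_i F (lift ord0 i) z)).
  by apply: rationalD => //; exact: IH.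
by move=> z _; rewrite big_ord_recl.
Qed.

Lemma rational_comp (T' J' : Type) (y : J' -> T' -> K) (s : T -> T') P :
  (forall j, rational_on A (y j \o s)) -> polyfun y P -> rational_on A (P \o s).
Proof.
move=> xs; elim=> [c|j|P1 P2 _ IH1 _ IH2|P1 P2 _ IH1 _ IH2].
- exact/rational_poly/polyfun_const.
- exact: xs.
- exact: rationalD IH1 IH2.
- exact: rationalM IH1 IH2.
Qed.

End RationalFunctions.

(** * Isomorphisms from a polynomial section and rational coordinates *)

Section FlagIsomorphism.
Variables (K : fieldType) (d N : nat).
Local Notation L := (laurent K).
Local Notation G := 'M[L]_2.
Local Notation loop := (@loop_coord K).
Local Notation aff := (@affine_coord K d).
Variables (T : set 'rV[K]_d) (S : set (set G)) (s : 'rV[K]_d -> G).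
Variable F : 'I_d -> G -> K.
Hypothesis s_SL2 : forall v, T v -> SL2 K (s v).
Hypothesis s_pole : forall v, T v -> pole_le N (s v).
Hypothesis S_def : S = [set iw_coset (s v) | v in T].
Hypothesis s_poly : forall j, polyfun aff (loop j \o s).
Hypothesis F_rational : forall j, rational_on loop (flag_preimage S) (F j).
Hypothesis F_s : forall v g j, T v -> iw_coset g = iw_coset (s v) -> F j g = v 0 j.

(** Regularity on the flag variety is tested on representatives.  Hence the inverse
    [phi] of [v |-> iw_coset (s v)] pulls polynomial conditions on [v] back to rational
    ones on [g], through [F], and the section [s] pulls polynomial conditions on [g]
    back to polynomial ones on [v].  The compatibility [F_s] also makes
    [v |-> iw_coset (s v)] injective on [T]. *)
Lemma flag_isomorphic : isomorphic (flag_subspace S) (affine_subspace T).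
Proof.
pose phi X := xget 0 [set v | T v /\ iw_coset (s v) = X].
have phiP X : S X -> T (phi X) /\ iw_coset (s (phi X)) = X.
  rewrite S_def => -[v Tv vX]; rewrite /phi.
  by case: xgetP => [w -> //|/(_ v)[]].
have s_S v : T v -> S (iw_coset (s v)) by rewrite S_def => Tv; exists v.
have phi_s v : T v -> phi (iw_coset (s v)) = v.
  move=> Tv; have [Tw ws] := phiP _ (s_S v Tv); apply/rowP => j.
  by rewrite -(F_s j Tw (esym ws)) (F_s j Tv erefl).
pose psi := phi \o @iw_coset K.
have psi_rat P : polyfun aff P -> rational_on loop (flag_preimage S) (P \o psi).
  apply: rational_comp => j; apply: rational_eq (F_rational j) _ => g [_ Sg].
  by have [Tg gs] := phiP _ Sg; rewrite (F_s j Tg (esym gs)).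
have s_comp P : polyfun loop P -> polyfun aff (P \o s) by exact: polyfun_comp.
have s_pre V v : T v -> V v ->
    (flag_preimage (S `&` phi @^-1` V) `&` pole_le N) (s v).
  move=> Tv Vv; split; last exact: s_pole.
  by split; [exact: s_SL2|split; [exact: s_S|rewrite /= phi_s]].
exists phi => pre; split; rewrite /pre {pre} /=.
- split.
  + by move=> X /phiP[].
  + move=> X Y /set_mem/phiP[_ Xs] /set_mem/phiP[_ Ys] XY.
    by rewrite -Xs -Ys XY.
  + by move=> v Tv; exists (iw_coset (s v)); [exact: s_S|exact: phi_s].
- move=> V VT; split=> [[_ Vo]|[_ [_ Vo]]].
  + split; first by move=> X [].
    split=> [g [gSL [Sg _]] //|M]; split=> [g [[gSL [Sg _]] gM] //|g].
    case=> -[gSL [Sg Vg]] gM.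
    have [P [xP Pg PV]] := Vo _ Vg; have [A [B [xA xB ABP]]] := psi_rat P xP.
    (* If [P \o psi = A / B], the principal open set of [A] is inside that of
       [P \o psi]. *)
    exists A; split=> // [|z [[zSL Sz] zM] Az].
      have [Bg PgE] := ABP g (conj gSL Sg).
      by apply: contraNneq Pg => A0; have := PgE; rewrite /psi /= A0 mul0r => ->.
    have [Bz PzE] := ABP z (conj zSL Sz).
    split=> //; split=> //; split=> //; apply: PV; first by have [] := phiP _ Sz.
    by have := PzE; rewrite /psi /= => ->; rewrite mulf_neq0 ?invr_neq0.
  + split=> // v Vv; have Tv := VT v Vv.
    have [_ /(_ (s v) (s_pre V v Tv Vv))[P [xP Pv PV]]] := Vo N.
    exists (P \o s); split=> // [|z Tz Pz]; first exact: s_comp.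
    have sz : (flag_preimage S `&` pole_le N) (s z).
      by split; [split; [exact: s_SL2|exact: s_S]|exact: s_pole].
    have [[_ [_ Vz]] _] := PV (s z) sz Pz.
    by move: Vz; rewrite /= phi_s.
- move=> V h [VT _]; split=> [hV M g [[gSL [Sg Vg]] gM]|hV v Vv].
  + have [P [Q [xP xQ Qg hPQ]]] := hV _ Vg.
    have [A [B [xA xB ABP]]] := psi_rat P xP.
    have [A' [B' [xA' xB' ABQ]]] := psi_rat Q xQ.
    have BA0 z : flag_preimage S z ->
        (B z * A' z != 0) = (Q (phi (iw_coset z)) != 0).
      move=> Sz; have [Bz _] := ABP z Sz; have [B'z QzE] := ABQ z Sz.
      move: QzE; rewrite /psi /= => ->.
      by rewrite !mulf_eq0 invr_eq0 (negPf Bz) (negPf B'z) orbF.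
    (* [(A / B) / (A' / B')] as a single fraction. *)
    exists (fun z => A z * B' z), (fun z => B z * A' z); split.
    * exact: polyfun_mul.
    * exact: polyfun_mul.
    * by rewrite BA0.
    * move=> z [[zSL [Sz Vz]] zM] BAz; have Sz' : flag_preimage S z by [].
      move: (BAz); rewrite BA0// => Qz; rewrite /= (hPQ _ Vz Qz).
      have [_ Pz] := ABP z Sz'; have [_ Qz'] := ABQ z Sz'.
      rewrite -[P _]/((P \o psi) z) -[Q _]/((Q \o psi) z) Pz Qz'.
      by rewrite invf_div mulf_div.
  + have Tv := VT v Vv.
    have [P [Q [xP xQ Qv hPQ]]] := hV N (s v) (s_pre V v Tv Vv).
    exists (P \o s), (Q \o s); split=> //; try exact: s_comp.
    move=> z Vz Qz; have Tz := VT z Vz.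
    by have := hPQ (s z) (s_pre V z Tz Vz) Qz; rewrite /= phi_s.
Qed.

End FlagIsomorphism.

(** * Coordinates on the cells *)

Section RowSeries.
Variable K : fieldType.
Local Notation L := (laurent K).
Implicit Types P : L.

(** The entries of [v] become the coefficients of [t^e], ..., [t^(e + d - 1)]. *)
Definition row_series e d (v : 'rV[K]_d) : L :=
  series e (fun m => (rVpoly v)`_(absz (m - e)%R)).

Lemma row_series_span (e d r : nat) (v : 'rV[K]_d) : (e + d = r.+1)%N ->
  lspan e r (row_series e v).
Proof.
move=> ed m; rewrite coef_series; case: ifP => [em|]; last by rewrite eqxx.
apply: contraNT => mr; rewrite nth_default//.
by apply: leq_trans (size_poly _ _) _; lia.
Qed.

Lemma coef_row_series (e d : nat) (v : 'rV[K]_d) (i : 'I_d) :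
  coef (row_series e v) (e%:Z + i%:Z) = v 0 i.
Proof.
rewrite coef_series ifT; last by lia.
by rewrite (_ : absz _ = i) ?coef_rVpoly_ord//; lia.
Qed.

Lemma row_series_surj (e d r : nat) P : (e + d = r.+1)%N -> lspan e r P ->
  row_series e (\row_(i < d) coef P (e%:Z + i%:Z)) = P.
Proof.
move=> ed Pe; apply: laurentP => m.
have [em|em] := boolP (e%:Z <= m <= r%:Z); last first.
  by rewrite (contraNeq (Pe m) em) (contraNeq (@row_series_span e d r _ ed m) em).
have md : (absz (m - e%:Z)%R < d)%N by lia.
have -> : m = e%:Z + (Ordinal md)%:Z by move=> /=; lia.
by rewrite coef_row_series mxE.
Qed.

(** [f] is bounded below, so each coefficient of the product is a finite combination
    of the entries of [v]. *)
Lemma row_series_poly (e d : nat) (f : L) m :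
  polyfun (@affine_coord K d) (fun v => coef (row_series e v * f) m).
Proof.
have c0 k : polyfun (@affine_coord K d) (fun v => coef (row_series e v) k).
  have [ke|ek] := ltP k e%:Z.
    rewrite (_ : (fun _ => _) = fun=> 0); first exact: polyfun_const.
    by apply: funext => v; rewrite coef_series leNgt ke.
  rewrite (_ : (fun _ => _) = fun v => (rVpoly v)`_(absz (k - e%:Z)%R)); last first.
    by apply: funext => v; rewrite coef_series ek.
  case: (insubP 'I_d (absz (k - e%:Z)%R)) => [j _ jk|kd].
    rewrite (_ : (fun _ => _) = affine_coord j); first exact: polyfun_coord.
    by apply: funext => v; rewrite -jk coef_rVpoly_ord.
  rewrite (_ : (fun _ => _) = fun=> 0); first exact: polyfun_const.
  apply: funext => v; rewrite nth_default//.
  by apply: leq_trans (size_poly _ _) _; rewrite leqNgt.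
have [a fa] := coef_bound f.
have se (v : 'rV[K]_d) : ord_ge e (row_series e v) by exact: ord_ge_series.
have [mea|eam] := ltP m (e%:Z + a).
  rewrite (_ : (fun _ => _) = fun=> 0); first exact: polyfun_const.
  by apply: funext => v; rewrite (ord_geM (se v) fa).
have -> : m = e%:Z + a + (absz (m - (e%:Z + a))%R)%:Z by lia.
set k := absz _.
rewrite (_ : (fun _ => _) = fun v => \sum_(j < k.+1)
    coef (row_series e v) (e%:Z + j%:Z) * coef f (a + (k - j)%N%:Z)).
  by apply: polyfun_sum => j; apply: polyfun_mul => //; exact: polyfun_const.
by apply: funext => v; exact: (convE (se v) fa).
Qed.

End RowSeries.

Section Cells.
Variable K : fieldType.
Local Notation L := (laurent K).
Local Notation t := (@tpow K).
Local Notation G := 'M[L]_2.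
Local Notation loop := (@loop_coord K).
Variables (b : bool) (n : int) (r : nat).
Hypothesis nbr : n + n + b%:Z = r.+1%:Z.
Implicit Types (g : G) (P Q : L).

(** The column of a representative that determines the point: the one in which the
    lower entry of [base_point b n] is nonzero. *)
Definition pivot : 'I_2 := if b then 0 else 1.

(** With [g = shear P * base_point * k], the column is [(z + P y, y)] where [y] is, up
    to sign, a diagonal entry of [k], hence a unit, and [z] is [t^(2n)] times an
    off-diagonal entry of [k]. *)
Lemma flag_point_column P g : iw_coset g = flag_point b n P ->
  let x := t n * g 0 pivot in let y := t n * g 1 pivot in
  [/\ ord_ge 0 y, coef y 0 != 0 & ord_ge r.+1 (x - P * y)].
Proof.
move=> /iw_coset_eq[k Ik ->]; have := congruence_unit (isT : (0 < 0 + 1)%N) Ik.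
have [_ [k00 k01 k10 k11]] := (congruenceP 0 1 k).1 Ik.
move=> /eqP kk.
have a0 : coef (k 0 0) 0 != 0.
  by apply: contraTneq kk => ->; rewrite mul0r eq_sym oner_eq0.
have d0 : coef (k 1 1) 0 != 0.
  by apply: contraTneq kk => ->; rewrite mulr0 eq_sym oner_eq0.
rewrite {kk} [k in _ *m k]mx2_eta -mulmxA /base_point /pivot.
have tt c i : ord_ge i c -> r.+1%:Z <= n + n + i -> ord_ge r.+1 (t n * (t n * c)).
  move=> ci ri; rewrite mulrA -tpowD.
  exact: (ord_geMw (@ord_ge_tpow K _) ci).
case: b nbr => nr; rewrite mx2M shear_mulmx !mx2E;
    rewrite !(mul0r, mulr0, addr0, add0r, mulNr, mulrN, mulrDr);
    rewrite [t n * (P * (t (- n) * _))]mulrCA !tpowVK addrK.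
  split; [exact: ord_geN|by rewrite lcoefN oppr_eq0|].
  by apply: tt k10 _; lia.
by split=> //; apply: tt k01 _; lia.
Qed.

(** The congruence [x = P y] modulo [t^(r+1)] is a triangular linear system for the
    coefficients of [P], with [y(0)] on its diagonal. *)
Lemma flag_point_coef_rational (i : nat) : (i <= r)%N -> exists f,
  rational_on loop [set g | coef (g 1 pivot) (- n) != 0] f /\
  forall P g, ord_ge 0 P -> iw_coset g = flag_point b n P -> f g = coef P i.
Proof.
elim/ltn_ind: i => i IH ir.
have /choice[F HF] (j : 'I_i) : exists f : G -> K,
    rational_on loop [set g | coef (g 1 pivot) (- n) != 0] f /\
    forall P g, ord_ge 0 P -> iw_coset g = flag_point b n P -> f g = coef P j.
  by apply: IH => //; apply: leq_trans ir; exact: ltnW.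
exists (fun g => (coef (g 0 pivot) (i%:Z - n) +
  -1 * \sum_(j < i) F j g * coef (g 1 pivot) ((i - j)%N%:Z - n)) *
  (coef (g 1 pivot) (- n))^-1); split.
  apply: rationalM; last first.
    by apply: rationalV => //; exact: (polyfun_coord loop (1, pivot, - n)).
  apply: rationalD.
    exact/rational_poly/(polyfun_coord loop (0, pivot, i%:Z - n)).
  apply: rationalM; first exact/rational_poly/polyfun_const.
  apply: rational_sum => j; apply: rationalM; first by have [] := HF j.
  exact/rational_poly/(polyfun_coord loop (1, pivot, _)).
move=> P g P0 gP; have [y0 yN0 xPy] := flag_point_column gP.
have := xPy i (_ : i%:Z < r.+1%:Z); rewrite lcoefD lcoefN => /(_ ir)/eqP.
rewrite subr_eq0 (lcoefM_last P0 y0) coef_tpowM => /eqP ->.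
move: yN0; rewrite !coef_tpowM sub0r => yN0.
have -> : \sum_(j < i) F j g * coef (g 1 pivot) ((i - j)%N%:Z - n) =
    \sum_(j < i) coef P j * coef (t n * g 1 pivot) (i - j)%N.
  apply: eq_bigr => j _; rewrite coef_tpowM.
  by have [_ /(_ P g P0 gP) ->] := HF j.
by field.
Qed.

Lemma flag_point_inj P Q : lspan 0 r P -> lspan 0 r Q ->
  flag_point b n P = flag_point b n Q -> P = Q.
Proof.
move=> Pr Qr PQ; apply: laurentP => m.
have [m0r|m0r] := boolP (0 <= m <= r%:Z); last first.
  by rewrite (contraNeq (Pr m) m0r) (contraNeq (Qr m) m0r).
case: m m0r => // i ir; have [//|f [_ fP]] := @flag_point_coef_rational i.
by rewrite -(fP P _ (lspan_ord Pr) erefl) (fP Q _ (lspan_ord Qr)).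
Qed.

Lemma base_point_pole : pole_le (absz n) (base_point K b n).
Proof.
move=> i j m mn; rewrite /base_point; case: b; rewrite mxE; do 2 case: ifP => _ //.
all: rewrite ?lcoefN ord_ge_tpow ?oppr0//; lia.
Qed.

(** With [e = 0] the coordinates are all the coefficients of [P]; with [e = 1] the
    constant term is fixed to zero. *)
Lemma cell_isomorphic (e d : nat) (T : set 'rV[K]_d) : (e + d = r.+1)%N ->
  isomorphic (flag_subspace [set flag_point b n (row_series e v) | v in T])
    (affine_subspace T).
Proof.
move=> ed.
have rp (i : 'I_d) : (e + i <= r)%N by have := ltn_ord i; lia.
have /choice[F HF] (i : 'I_d) := flag_point_coef_rational (rp i).
have so (v : 'rV[K]_d) : ord_ge 0 (row_series e v) by exact: ord_ge_series.
pose s (v : 'rV[K]_d) := shear (row_series e v) *m base_point K b n.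
apply: (@flag_isomorphic K d (absz n) T _ s F) => //.
- by move=> v _; rewrite /s /SL2/= det_mulmx det_shear det_base_point mulr1.
- move=> v _ i j m mn; have bm l := @base_point_pole l j m mn.
  have sb : coef (row_series e v * base_point K b n 1 j) m = 0.
    by apply: (ord_geM (so v) (@base_point_pole 1 j)); rewrite add0r.
  by rewrite /s shear_mulmxE; case: (i == 0); rewrite ?lcoefD ?bm ?sb ?addr0.
- move=> [[i j] m]; rewrite (_ : _ \o _ = fun v => if i == 0 then
      coef (base_point K b n 0 j) m + coef (row_series e v * base_point K b n 1 j) m
    else coef (base_point K b n 1 j) m).
    case: (i == 0); last exact: polyfun_const.
    by apply: polyfun_add; [exact: polyfun_const|exact: row_series_poly].
  apply: funext => v; rewrite -[LHS]/(coef (s v i j) m).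
  by rewrite /s shear_mulmxE; case: (i == 0).
- move=> i; have [[P [Q [xP xQ PQ]]] _] := HF i; exists P, Q; split=> //.
  move=> g [_ [v Tv /esym gv]]; apply: PQ.
  by have [_ + _] := flag_point_column gv; rewrite coef_tpowM sub0r.
- move=> v g i Tv gv; have [_ /(_ _ g (so v) gv) ->] := HF i.
  by rewrite PoszD coef_row_series.
Qed.

End Cells.

(** * The decomposition *)

Section Decomposition.
Variable K : fieldType.
Local Notation L := (laurent K).
Local Notation t := (@tpow K).

Lemma is_orbit_flag_orbit (H : set 'M[L]_2) b n (P : L) :
  is_orbit H (flag_orbit H (flag_point b n P)).
Proof. by exists (flag_point b n P) => //; exact: flag_point_affine_flag. Qed.

(** Constant shears fix the base point, by [iw_coset_base_point] with [N = 2n + b <= 0].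
    The one by [- b(0) / a(0)] brings [h = (a, b; c, d)] into [I_1] without changing
    the image of the base point. *)
Lemma Iwahori_orbit_I1 (b : bool) (n : int) : n + n + b%:Z <= 0 ->
  flag_orbit (Iwahori K) (flag_point b n 0) =
  flag_orbit (I1 K) (flag_point b n 0).
Proof.
move=> nb; apply/seteqP; split=> _ [h Ih <-]; last first.
  by exists h => //; apply: congruence_sub Ih.
pose c : L := series 0
  (fun i => if i == 0 then coef (h 0 1) 0 / coef (h 0 0) 0 else 0).
have c0 : ord_ge 0 c by exact: ord_ge_series.
have Ihc : Iwahori K (h *m shear (- c)).
  by apply: congruenceM => //; apply: shear_congruence; exact: ord_geN.
exists (h *m shear (- c)); last first.
  rewrite /flag_point !translate_iw_coset [shear 0]/shear -mx2_1 !mul1mx.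
  apply: iw_coset_base_point; rewrite ?det_shear// !mx2E.
  - exact: ord_ge1.
  - by apply/ord_geN/(ord_ge_le _ c0).
  - exact: ord_ge0.
  - exact: ord_ge1.
have [dhc [hc00 hc01 hc10 hc11]] := (congruenceP 0 1 _).1 Ihc.
apply/congruenceP; split=> //; split=> // i i1.
have [i0|] := ltP i 0; first exact: hc01.
case: i i1 => // -[|//] _ _.
have [_ [h00 h01 h10 h11]] := (congruenceP 0 1 h).1 Ih.
rewrite [h]mx2_eta mx2M mx2E mulr1 mulrN lcoefD lcoefN (lcoefM_lead h00 c0).
rewrite coef_series /= mulrC divfK ?addNr//.
have /eqP := congruence_unit (isT : (0 < 0 + 1)%N) Ih.
by apply: contraTneq => ->; rewrite mul0r eq_sym oner_eq0.
Qed.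

Section Cells.
Hypothesis K_sqrt : forall x : K, exists y, y ^+ 2 = x.
Hypothesis K_2 : 2%:R != 0 :> K.
Variables (b : bool) (n : int) (r : nat).
Hypothesis nbr : n + n + b%:Z = r.+1%:Z.

Let cell_o := flag_point b n @` @lspan_unit K 0 r.
Let cell_h := flag_point b n @` @lspan K 1 r.

Lemma cell_h_isomorphic : isomorphic (flag_subspace cell_h) (affine_space K r).
Proof.
suff -> : cell_h =
    [set flag_point b n (row_series 1 v) | v in [set: 'rV[K]_r]].
  exact: (cell_isomorphic nbr _ (add1n r)).
apply/seteqP; split=> [_ [P Pr <-]|_ [v _ <-]].
  exists (\row_(i < r) coef P (1%N%:Z + i%:Z)) => //.
  by rewrite (row_series_surj (add1n r)).
by exists (row_series 1 v) => //; exact: row_series_span (add1n r).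
Qed.

Lemma cell_o_isomorphic : isomorphic (flag_subspace cell_o) (Gm_affine_space K r).
Proof.
suff -> : cell_o = [set flag_point b n (row_series 0 v) |
    v in [set v : 'rV[K]_r.+1 | v 0 0 != 0]].
  exact: (cell_isomorphic nbr _ (add0n r.+1)).
apply/seteqP; split=> [_ [P [Pr P0] <-]|_ [v v0 <-]].
  exists (\row_(i < r.+1) coef P (0%N%:Z + i%:Z)); first by rewrite /= mxE.
  by rewrite (row_series_surj (add0n r.+1)).
exists (row_series 0 v) => //; split; first exact: row_series_span (add0n r.+1).
by have := coef_row_series 0 v 0; rewrite addr0 => ->.
Qed.

(** Both families of points at once; [P] is any base point of the open piece, since
    the two families start from [1] and [-1]. *)
Lemma cell_decomposition P : lspan_unit 0 r P ->
  [/\ flag_orbit (Iwahori K) (flag_point b n 0) = cell_o `|` cell_h,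
      cell_o `&` cell_h = set0,
      is_orbit (I1 K) cell_o /\ is_orbit (I1 K) cell_h,
      isomorphic (flag_subspace cell_o) (Gm_affine_space K r) /\
      isomorphic (flag_subspace cell_h) (affine_space K r) &
      cell_o `<=` flag_orbit (I3 K) (flag_point b n P) /\
      cell_h `<=` flag_orbit (I2 K) (flag_point b n 0)].
Proof.
move=> Pu; split.
- by rewrite (Iwahori_orbit K nbr) lspan_split image_setU.
- apply/seteqP; split=> // _ [[Q [Qr Q0] <-] [Q' Q'r QQ']].
  have Q'0 : lspan 0 r Q' by move=> m /Q'r; lia.
  have QE := flag_point_inj nbr Q'0 Qr QQ'.
  by have := Q'r 0; rewrite QE => /(_ Q0).
- split; last by rewrite /cell_h -(I1_orbit_h K nbr); exact: is_orbit_flag_orbit.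
  by rewrite /cell_o -(I1_orbit_o nbr K_sqrt K_2 Pu); exact: is_orbit_flag_orbit.
- by split; [exact: cell_o_isomorphic|exact: cell_h_isomorphic].
- split; last exact: I2_transitive_h.
  have [Pr P0] := Pu.
  move=> _ [Q [Qr Q0] <-].
  have [h hI hE] := I3_transitive_o nbr K_sqrt K_2 (lspan_ord Pr) P0
    (lspan_ord Qr) Q0.
  by exists h.
Qed.

End Cells.

Lemma lspan_tpow i j n (p : L) : lspan (i - n) (j - n) p <-> lspan i j (t n * p).
Proof.
split=> pij m; first by rewrite coef_tpowM => /pij; lia.
by have := pij (m + n); rewrite coef_tpowM addrK => H /H; lia.
Qed.

Lemma lspan_unit_tpow i j n (p : L) :
  lspan_unit (i - n) (j - n) p <-> lspan_unit i j (t n * p).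
Proof.
by split=> -[pij pi]; split; first [exact/lspan_tpow|move: pi; rewrite coef_tpowM].
Qed.

Lemma lspanN i j (p : L) : lspan i j p <-> lspan i j (- p).
Proof. by split=> pij m; have := pij m; rewrite lcoefN oppr_eq0. Qed.

Lemma lspan_unitN i j (p : L) : lspan_unit i j p <-> lspan_unit i j (- p).
Proof.
split=> -[pij pi]; split.
- exact: (lspanN i j p).1.
- by rewrite lcoefN oppr_eq0.
- exact: (lspanN i j p).2.
- by move: pi; rewrite lcoefN oppr_eq0.
Qed.

Lemma brk_image n (A B : set L) : (forall p, A p <-> B (t n * p)) ->
  [set brk n p | p in A] = flag_point false n @` B.
Proof.
move=> AB; apply/seteqP; split=> [_ [p /AB Bp <-]|_ [P BP <-]].
  by exists (t n * p) => //; rewrite brkE.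
by exists (t (- n) * P); rewrite ?brkE ?AB tpowVK.
Qed.

Lemma brk'_image n (A B : set L) : (forall p, A p <-> B (- (t n * p))) ->
  [set brk' n p | p in A] = flag_point true n @` B.
Proof.
move=> AB; apply/seteqP; split=> [_ [p /AB Bp <-]|_ [P BP <-]].
  by exists (- (t n * p)) => //; rewrite brk'E.
by exists (- (t (- n) * P)); rewrite ?brk'E ?AB mulrN tpowVK opprK.
Qed.

Lemma orbEE n : orbE K n = flag_orbit (Iwahori K) (flag_point false n 0).
Proof. by rewrite /orbE brkE mulr0. Qed.

Lemma orbOE n : orbO K n = flag_orbit (Iwahori K) (flag_point true n 0).
Proof. by rewrite /orbO brk'E mulr0 oppr0. Qed.

(** For [[n, p]] the number of coefficients of [p] is [2n], whence [r = 2n - 1]. *)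
Section CellsE.
Variables (n : int) (r : nat).
Hypothesis nr : n + n + false%:Z = r.+1%:Z.

Lemma orbE_oE : orbE_o K n = flag_point false n @` @lspan_unit K 0 r.
Proof.
apply: brk_image => p; rewrite -lspan_unit_tpow sub0r.
by have -> : r%:Z - n = n - 1 by lia.
Qed.

Lemma orbE_hE : orbE_h K n = flag_point false n @` @lspan K 1 r.
Proof.
apply: brk_image => p; rewrite -lspan_tpow.
by have -> : r%:Z - n = n - 1 by lia.
Qed.

End CellsE.

(** For [[n, p]'] the exponent [n] is allowed in [p], whence [r = 2n]. *)
Section CellsO.
Variables (n : int) (r : nat).
Hypothesis nr : n + n + true%:Z = r.+1%:Z.

Lemma orbO_oE : orbO_o K n = flag_point true n @` @lspan_unit K 0 r.
Proof.
apply: brk'_image => p; rewrite -lspan_unitN -lspan_unit_tpow sub0r.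
by have -> : r%:Z - n = n by lia.
Qed.

Lemma orbO_hE : orbO_h K n = flag_point true n @` @lspan K 1 r.
Proof.
apply: brk'_image => p; rewrite -lspanN -lspan_tpow.
by have -> : r%:Z - n = n by lia.
Qed.

End CellsO.

Lemma lspan_unit1 (r : nat) : @lspan_unit K 0 r 1.
Proof.
split=> [m|]; last by rewrite lcoef1 oner_neq0.
by rewrite lcoef1; case: (m =P 0) => [-> //|_]; rewrite eqxx.
Qed.

End Decomposition.

Theorem proposition4p1 (R : realType) :
  let C : fieldType := R[i] in
  [/\ (forall n : int, n < 0 -> is_orbit (I1 C) (orbE C n)),
      (forall n : int, n < 0 -> is_orbit (I1 C) (orbO C n)),
      (forall n : nat, (0 < n)%N ->
         [/\ orbE C n = orbE_o C n `|` orbE_h C n,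
             orbE_o C n `&` orbE_h C n = set0,
             is_orbit (I1 C) (orbE_o C n) /\ is_orbit (I1 C) (orbE_h C n),
             isomorphic (flag_subspace (orbE_o C n))
                        (Gm_affine_space C (2 * n - 1)) /\
             isomorphic (flag_subspace (orbE_h C n))
                        (affine_space C (2 * n - 1)) &
             orbE_o C n `<=` flag_orbit (I3 C) (brk n (tpow C (- n%:Z))) /\
             orbE_h C n `<=` flag_orbit (I2 C) (brk n 0)]) &
      (forall n : nat,
         [/\ orbO C n = orbO_o C n `|` orbO_h C n,
             orbO_o C n `&` orbO_h C n = set0,
             is_orbit (I1 C) (orbO_o C n) /\ is_orbit (I1 C) (orbO_h C n),
             isomorphic (flag_subspace (orbO_o C n))
                        (Gm_affine_space C (2 * n)) /\
             isomorphic (flag_subspace (orbO_h C n))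
                        (affine_space C (2 * n)) &
             orbO_o C n `<=` flag_orbit (I3 C) (brk' n (tpow C (- n%:Z))) /\
             orbO_h C n `<=` flag_orbit (I2 C) (brk' n 0)])].
Proof.
move=> C.
have C_sqrt (x : C) : exists y, y ^+ 2 = x by exists (sqrtC x); exact: sqrtCK.
have C_2 : 2%:R != 0 :> C by rewrite pnatr_eq0.
split=> [n n0|n n0|n n0|n].
- rewrite orbEE Iwahori_orbit_I1; last by lia.
  exact: is_orbit_flag_orbit.
- rewrite orbOE Iwahori_orbit_I1; last by lia.
  exact: is_orbit_flag_orbit.
- have nr : n%:Z + n%:Z + false%:Z = (2 * n - 1).+1%:Z by lia.
  rewrite orbEE (orbE_oE C nr) (orbE_hE C nr) !brkE mulr0 tpowK.
  by apply: cell_decomposition => //; exact: lspan_unit1.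
- have nr : n%:Z + n%:Z + true%:Z = (2 * n).+1%:Z by lia.
  rewrite orbOE (orbO_oE C nr) (orbO_hE C nr) !brk'E mulr0 oppr0 tpowK.
  apply: cell_decomposition => //; apply/lspan_unitN; rewrite opprK.
  exact: lspan_unit1.
Qed.
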